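(* Let $X\subset\mathbb{R}$ be an interval and $(X,T,\mu)$ a probability preserving dynamical system which is exponentially 4-mixing for $BV$ against $L^\infty$, with the constant $C'$ uniformly bounded when $\psi_1,\psi_2,\varphi_1,\varphi_2$ are indicator functions of intervals. Let $(r_n)_n$ be a sequence of positive numbers with $r_n\ge n^{-\beta}$ for some $\beta>0$, and suppose that for some function $h(n)\to\infty$, \[ \int\mu(B(y,r_n))\,d\mu(y)\ge\frac{(\log n)^2h(n)}{n^2} \] for all large $n$. Then $\mu(\limsup_n F_{n,4r_n}^T)=1$.
   Context: $(X,T,\mu)$ is exponentially 4-mixing for $BV$ against $L^\infty$ if there is $\theta'>0$ such that for all $\psi_1,\psi_2$ of bounded variation, all $\varphi_1,\varphi_2\in L^\infty(\mu)$, and all integers $0\le a<b\le c$, $\bigl|\int\psi_1\cdot\psi_2\circ T^a\cdot\varphi_1\circ T^b\cdot\varphi_2\circ T^c\,d\mu-\int\psi_1\cdot\psi_2\circ T^a\,d\mu\int\varphi_1\cdot\varphi_2\circ T^{c-b}\,d\mu\bigr|\le C'(\psi_1,\psi_2,\varphi_1,\varphi_2)e^{-\theta'(b-a)}$ for some constant $C'(\psi_1,\psi_2,\varphi_1,\varphi_2)<\infty$. For $n\in\mathbb{N}$, $r>0$: $F_{n,r}^T:=\{x\in X: |T^ix-T^jx|<r \text{ for some } 0\le i<j<n\}$; $F_{n,4r_n}^T$ is this set with $r=4r_n$. $B(y,r)$ is the open ball of radius $r$ about $y$. *)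

(* Defs.v *)
From HB Require Import structures.
From mathcomp Require Import all_boot all_order all_algebra.
From mathcomp Require Import all_classical all_reals all_analysis.
Set Implicit Arguments. Unset Strict Implicit. Unset Printing Implicit Defensive.
Import Order.TTheory GRing.Theory Num.Theory.
Import numFieldNormedType.Exports.
Local Open Scope classical_set_scope.
Local Open Scope ring_scope.

Definition BV_on {R : realType} (X : set R) (f : R -> R) : Prop :=
  exists M : R, forall s : seq R, sorted <=%R s -> (forall x, x \in s -> X x) ->
    \sum_(i < (size s).-1) `|f (nth 0 s i.+1) - f (nth 0 s i)| <= M.

Definition Linfty_on {d} {T : measurableType d} {R : realType}
  (mu : {measure set T -> \bar R}) (X : set T) (phi : T -> R) : Prop :=
  measurable_fun X phi /\ exists M : R, {ae mu, forall x, `|phi x| <= M}.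

Definition mix4 {d} {T : measurableType d} {R : realType}
  (mu : {measure set T -> \bar R}) (X : set T) (Tm : T -> T)
  (psi1 psi2 phi1 phi2 : T -> R) (a b c : nat) : R :=
  `| Rintegral mu X (fun x => psi1 x * psi2 (iter a Tm x)
                               * phi1 (iter b Tm x) * phi2 (iter c Tm x))
     - Rintegral mu X (fun x => psi1 x * psi2 (iter a Tm x))
       * Rintegral mu X (fun x => phi1 x * phi2 (iter (c - b) Tm x)) |.

Definition exp_4mixing_BV_Linfty {R : realType}
  (mu : {measure set R -> \bar R}) (X : set R) (Tm : R -> R) (theta' : R) : Prop :=
  forall psi1 psi2 phi1 phi2 : R -> R,
    BV_on X psi1 -> BV_on X psi2 -> Linfty_on mu X phi1 -> Linfty_on mu X phi2 ->
    exists C' : R, forall a b c : nat, (a < b)%N -> (b <= c)%N ->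
      mix4 mu X Tm psi1 psi2 phi1 phi2 a b c <= C' * expR (- theta' * (b - a)%:R).

Definition F_set {R : realType} (X : set R) (Tm : R -> R) (n : nat) (r : R) : set R :=
  [set x | X x /\ exists i j : nat, (i < j)%N /\ (j < n)%N /\
                   `|iter i Tm x - iter j Tm x| < r].

Definition limsup_set {T} (A : nat -> set T) : set T :=
  [set x | forall N : nat, exists n : nat, (N <= n)%N /\ A n x].

(* Main.v *)
Require Import Defs.
From HB Require Import structures.
From mathcomp Require Import all_boot all_order all_algebra.
From mathcomp Require Import all_classical all_reals all_analysis.
From mathcomp Require Import measurable_realfun ring lra zify.
Import Order.TTheory GRing.Theory Num.Theory.
Import numFieldNormedType.Exports.
Local Open Scope classical_set_scope.
Local Open Scope ring_scope.

(** Fix n, a gap g of order log n, and disjoint half-open intervals A k of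
    length 4 r_n.  With m = n / (2g), let N x be the number of triples (k, u, v)
    with u, v < m such that T^(g u) x and T^(g (m + v)) x both lie in A k, so
    that N x > 0 forces x into F_{n, 4 r_n}.  Four-fold mixing over gaps at
    least g makes these visits independent up to e = C exp(- theta g).  For
    S = sum_k mu(A k)^2 and L cells this gives E N >= m^2 (S - L e) and
    E N^2 <= (1 + t) m^4 S^2 + (1 + 1/t) m^2 S + 6 m^4 e L^2, and
      mu(N = 0) <= E (1 - N / (m^2 S))^2
    tends to 0, because S is at least a constant times
    the integral of mu(B(y, r_n)) while L is at most 8 n^2.  Hence
    mu(F_{n, 4 r_n}) tends to 1, which already gives limsup full measure. *)

(** * Algebra behind the second-moment bound *)

Lemma sumr_finType_const {V : pzRingType} (K : finType) (x : V) :
  \sum_(k : K) x = #|K|%:R * x.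
Proof. by rewrite sumr_const mulr_natl; congr (_ *+ _); exact: eq_card. Qed.

(** [J] and [J'] stand for correlations of cells [k], [l] in the early and late time blocks. Write
    their common bound as x + y + z: independent part, coinciding times, mixing error. In its
    square, 2xy is split with weight [t], which keeps the leading coefficient at 1 + t. The terms
    with z cost at most 5 M^2 z because x, y, z are at most M^2. *)
Lemma sum_pair_bound {R : realType} (K : finType) (p : K -> R) (M e t : R)
    (J J' : K -> K -> R) :
  (forall k, 0 <= p k <= 1) -> 1 <= M -> 0 <= e <= 1 -> 0 < t ->
  (forall k l, 0 <= J k l <=
    M ^+ 2 * (p k * p l) + (k == l)%:R * (M * p k) + M ^+ 2 * e) ->
  (forall k l, 0 <= J' k l <=
    M ^+ 2 * (p k * p l) + (k == l)%:R * (M * p k) + M ^+ 2 * e) ->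
  \sum_k \sum_l J k l * J' k l <=
    (1 + t) * M ^+ 4 * (\sum_k p k ^+ 2) ^+ 2
    + (1 + t^-1) * M ^+ 2 * (\sum_k p k ^+ 2) + 5 * M ^+ 4 * e * #|K|%:R ^+ 2.
Proof.
move=> p01 M1 /andP[e0 e1] t0 HJ HJ'.
have key k l : J k l * J' k l <=
    (1 + t) * M ^+ 4 * (p k ^+ 2 * p l ^+ 2)
    + ((k == l)%:R * ((1 + t^-1) * M ^+ 2 * p k ^+ 2) + 5 * M ^+ 4 * e).
  have [J0 JW] := andP (HJ k l); have [J'0 J'W] := andP (HJ' k l).
  have {J0 JW J'0 J'W} := ler_pM J0 J'0 JW J'W.
  set x := M ^+ 2 * (p k * p l); set y := _ * (M * p k); set z := M ^+ 2 * e.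
  move=> /le_trans; apply.
  have /andP[pk0 pk1] := p01 k; have /andP[pl0 pl1] := p01 l.
  have M2 : 1 <= M ^+ 2 by rewrite -(expr1n _ 2) lerXn2r ?nnegrE//; lra.
  have M0 : 0 <= M by lra.
  have M20 : 0 <= M ^+ 2 by lra.
  have x0 : 0 <= x by rewrite !mulr_ge0.
  have xM : x <= M ^+ 2.
    by rewrite ler_piMr ?mulr_ile1//; lra.
  have y0 : 0 <= y by rewrite !mulr_ge0//; lra.
  have yM : y <= M ^+ 2.
    rewrite /y; case: eqP => _; last by rewrite mul0r; lra.
    rewrite mul1r expr2 ler_pM//; lra.
  have y2 : y ^+ 2 = (k == l)%:R * (M ^+ 2 * p k ^+ 2).
    by rewrite /y; case: eqP => _; rewrite ?mul1r ?mul0r ?expr0n// exprMn.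
  have z0 : 0 <= z by rewrite mulr_ge0//; lra.
  have zM : z <= M ^+ 2 by rewrite ler_piMr//; lra.
  have xy : 2 * (x * y) <= t * x ^+ 2 + t^-1 * y ^+ 2.
    rewrite -subr_ge0 (_ : _ - _ = t^-1 * (t * x - y) ^+ 2).
      by rewrite mulr_ge0 ?sqr_ge0// invr_ge0 ltW.
    by field; rewrite gt_eqF.
  rewrite (_ : (1 + t) * M ^+ 4 * (p k ^+ 2 * p l ^+ 2) = (1 + t) * x ^+ 2);
    last by rewrite /x; ring.
  rewrite (_ : (k == l)%:R * _ = (1 + t^-1) * y ^+ 2); last first.
    by rewrite y2 !mulrA (mulrC (_%:R)).
  rewrite (_ : 5 * M ^+ 4 * e = 5 * M ^+ 2 * z); last by rewrite /z; ring.
  have : z * (2 * x + 2 * y + z) <= z * (5 * M ^+ 2).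
    by rewrite ler_wpM2l//; lra.
  lra.
apply: (@le_trans _ _ (\sum_k \sum_l ((1 + t) * M ^+ 4 * (p k ^+ 2 * p l ^+ 2)
    + ((k == l)%:R * ((1 + t^-1) * M ^+ 2 * p k ^+ 2) + 5 * M ^+ 4 * e)))).
  by apply: ler_sum => k _; apply: ler_sum => l _.
under eq_bigr do rewrite big_split/= big_split/=.
rewrite big_split/= big_split/= addrA !lerD//.
- rewrite [in leRHS]expr2 big_distrlr/= mulr_sumr.
  by apply: ler_sum => k _; rewrite mulr_sumr.
- rewrite [leRHS]mulr_sumr; apply: ler_sum => k _.
  rewrite (bigD1 k)//= eqxx mul1r big1 ?addr0// => l lk.
  by rewrite eq_sym (negbTE lk) mul0r.
- by rewrite !sumr_finType_const mulrA mulrC expr2.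
Qed.

(** * Integrals of bounded measurable functions *)

Section BoundedMeasurable.
Context {d : measure_display} {T : measurableType d} {R : realType}.
Variables (mu : probability T R) (X : set T).
Hypothesis mX : measurable X.

Definition bounded_measurable (f : T -> R) : Prop :=
  measurable_fun X f /\ exists M : R, forall x, X x -> `|f x| <= M.

Lemma bounded_measurable_integrable (f : T -> R) :
  bounded_measurable f -> mu.-integrable X (EFin \o f).
Proof.
move=> [mf [M fM]]; apply: measurable_bounded_integrable => //.
- by rewrite (le_lt_trans (probability_le1 mu mX))// ltry.
- exists M; split; first exact: num_real.
  by move=> y My x Xx; rewrite /= (le_trans (fM _ Xx))// ltW.
Qed.

Lemma bounded_measurable_cst (c : R) : bounded_measurable (fun=> c).
Proof. by split; [exact: measurable_cst | exists `|c|]. Qed.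

Lemma bounded_measurableD (f g : T -> R) : bounded_measurable f ->
  bounded_measurable g -> bounded_measurable (fun x => f x + g x).
Proof.
move=> [mf [M fM]] [mg [N gN]]; split; first exact: measurable_funD.
exists (M + N) => x Xx.
by rewrite (le_trans (ler_normD _ _))// lerD ?fM ?gN.
Qed.

Lemma bounded_measurableM (f g : T -> R) : bounded_measurable f ->
  bounded_measurable g -> bounded_measurable (fun x => f x * g x).
Proof.
move=> [mf [M fM]] [mg [N gN]]; split; first exact: measurable_funM.
by exists (M * N) => x Xx; rewrite normrM ler_pM ?fM ?gN.
Qed.

Lemma bounded_measurable_sum (I : Type) (s : seq I) (f : I -> T -> R) :
  (forall i, bounded_measurable (f i)) ->
  bounded_measurable (fun x => \sum_(i <- s) f i x).
Proof.
move=> bf; elim: s => [|i s IH].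
  under eq_fun do rewrite big_nil; exact: bounded_measurable_cst.
by under eq_fun do rewrite big_cons; apply: bounded_measurableD.
Qed.

Lemma Rintegral_sum (I : Type) (s : seq I) (f : I -> T -> R) :
  (forall i, bounded_measurable (f i)) ->
  Rintegral mu X (fun x => \sum_(i <- s) f i x) =
  \sum_(i <- s) Rintegral mu X (f i).
Proof.
move=> bf; elim: s => [|i s IH].
  rewrite big_nil; under eq_Rintegral do rewrite big_nil.
  by rewrite Rintegral_cst// mul0r.
rewrite big_cons -IH; under eq_Rintegral do rewrite big_cons.
rewrite RintegralD//; apply: bounded_measurable_integrable => //.
exact: bounded_measurable_sum.
Qed.

Lemma Rintegral_indic (A : set T) : measurable A ->
  Rintegral mu X (\1_A) = fine (mu (A `&` X)).
Proof. by move=> mA; rewrite /Rintegral integral_indic. Qed.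

(** Invariance of [mu] is given for sets; this carries it over to integrals of 0/1-valued
    functions. *)
Lemma Rintegral_01 (f : T -> R) : measurable_fun X f ->
  (forall x, X x -> f x = 0 \/ f x = 1) ->
  Rintegral mu X f = fine (mu (X `&` f @^-1` [set 1])).
Proof.
move=> mf f01; have mD : measurable (X `&` f @^-1` [set 1]) by exact: mf.
rewrite -[X in fine (mu X)](setIidl (_ : _ `<=` X)); last by move=> x [].
rewrite -Rintegral_indic//; apply: eq_Rintegral => x; rewrite inE => Xx.
case: (f01 x Xx) => fx; rewrite fx.
- rewrite memNset// => -[_]/=; rewrite fx => /eqP.
  by rewrite eq_sym oner_eq0.
- by rewrite mem_set.
Qed.

Lemma measure_setI_full A : mu X = 1%E -> measurable A ->
  mu (A `&` X) = mu A.
Proof.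
move=> muX mA; have mXC : measurable (~` X) by exact: measurableC.
have XC0 : mu (~` X) = 0%E by rewrite probability_setC// muX subee.
rewrite -[in RHS](setIT A) -(setUv X) setIUr measureU//.
- rewrite [X in (_ + X)%E](_ : _ = 0%E) ?adde0//.
  apply/eqP; rewrite eq_le measure_ge0 andbT -XC0.
  by apply: le_measure; rewrite ?inE//; exact: measurableI.
- exact: measurableI.
- exact: measurableI.
- by rewrite setIACA setICr setI0.
Qed.

End BoundedMeasurable.

(** * Invariance and hitting correlations along orbits *)

Section Orbits.
Context {R : realType}.
Variables (X : set R) (mu : probability R R) (Tm : R -> R).
Hypothesis mX : measurable X.
Hypothesis mT : measurable_fun X Tm.
Hypothesis TX : forall x, X x -> X (Tm x).
Hypothesis Tinv :
  forall A : set R, measurable A -> mu (X `&` Tm @^-1` A) = mu A.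

Lemma measurable_comp_stable (f : R -> R) : measurable_fun X f ->
  measurable_fun X (fun x => f (Tm x)).
Proof.
move=> mf; apply: (@measurable_comp _ _ _ _ _ _ X f X Tm) => //.
by move=> _ [x Xx <-]; exact: TX.
Qed.

Lemma measurable_comp_iter (f : R -> R) i : measurable_fun X f ->
  measurable_fun X (fun x => f (iter i Tm x)).
Proof.
elim: i f => //= i IH f mf.
apply: (IH (fun x => f (Tm x))); exact: measurable_comp_stable.
Qed.

Lemma Rintegral_comp_stable (f : R -> R) : measurable_fun X f ->
  (forall x, X x -> f x = 0 \/ f x = 1) ->
  Rintegral mu X (fun x => f (Tm x)) = Rintegral mu X f.
Proof.
move=> mf f01; rewrite !(Rintegral_01 mu)//; last 2 first.
- exact: measurable_comp_stable.
- by move=> x /TX; exact: f01.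
(* Invariance is applied after intersecting with [X], since [f] is measurable only on [X]. The
   preimage is unchanged because [Tm] maps [X] into itself. *)
rewrite -(Tinv (X `&` f @^-1` [set 1]))//; last exact: mf.
congr (fine (mu _)); apply/seteqP; split => x [Xx]/=; first by split=> //; split=> //; exact: TX.
by move=> [].
Qed.

Lemma Rintegral_comp_iter (f : R -> R) i : measurable_fun X f ->
  (forall x, X x -> f x = 0 \/ f x = 1) ->
  Rintegral mu X (fun x => f (iter i Tm x)) = Rintegral mu X f.
Proof.
elim: i f => //= i IH f mf f01.
rewrite (IH (fun x => f (Tm x))).
- exact: Rintegral_comp_stable.
- exact: measurable_comp_stable.
- by move=> x /TX; exact: f01.
Qed.

Definition hit (A : set R) (i : nat) (x : R) : R := \1_A (iter i Tm x).

Definition hit2 (A : set R) i (B : set R) j : R :=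
  Rintegral mu X (fun x => hit A i x * hit B j x).

(** The brackets separate an early pair from a late pair, the two factors that mixing decouples. *)
Definition hit4 (A : set R) i (B : set R) j (C : set R) k (D : set R) l : R :=
  Rintegral mu X (fun x => hit A i x * hit B j x * (hit C k x * hit D l x)).

Lemma hit01 A i x : hit A i x = 0 \/ hit A i x = 1.
Proof. by rewrite /hit indicE; case: (_ \in _); [right|left]. Qed.

Lemma hitT i x : hit [set: R] i x = 1.
Proof. by rewrite /hit indicT. Qed.

Lemma hit_shift A i k x : hit A (i + k) x = hit A i (iter k Tm x).
Proof. by rewrite /hit iterD. Qed.

Lemma measurable_hit A i : measurable A -> measurable_fun X (hit A i).
Proof. by move=> mA; apply: measurable_comp_iter; exact: measurable_indic. Qed.

Lemma bounded_measurable_hit A i : measurable A -> bounded_measurable X (hit A i).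
Proof.
move=> mA; split; first exact: measurable_hit.
by exists 1 => x _; case: (hit01 A i x) => ->; rewrite ?normr0 ?normr1.
Qed.

Lemma mul01 (a b : R) : a = 0 \/ a = 1 -> b = 0 \/ b = 1 -> a * b = 0 \/ a * b = 1.
Proof. by move=> [->|->] [->|->]; rewrite ?(mulr0, mul0r, mul1r); auto. Qed.

Lemma hit2C A i B j : hit2 A i B j = hit2 B j A i.
Proof. by rewrite /hit2; under eq_Rintegral do rewrite mulrC. Qed.

Lemma hit4Cl A i B j C k D l : hit4 A i B j C k D l = hit4 B j A i C k D l.
Proof.
by rewrite /hit4; under eq_Rintegral do rewrite (mulrC (hit A i _)).
Qed.

Lemma hit4Cr A i B j C k D l : hit4 A i B j C k D l = hit4 A i B j D l C k.
Proof.
by rewrite /hit4; under eq_Rintegral do rewrite (mulrC (hit C k _)).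
Qed.

Lemma hit2_ge0 A i B j : 0 <= hit2 A i B j.
Proof. by apply: Rintegral_ge0 => x _; rewrite mulr_ge0// /hit indicE. Qed.

Lemma hit2_shift A i B j k : measurable A -> measurable B ->
  hit2 A (i + k) B (j + k) = hit2 A i B j.
Proof.
move=> mA mB; rewrite /hit2; under eq_Rintegral do rewrite !hit_shift.
rewrite (Rintegral_comp_iter (fun x => hit A i x * hit B j x))//.
- by apply: measurable_funM; exact: measurable_hit.
- by move=> x _; apply: mul01; exact: hit01.
Qed.

Lemma hit4_shift A i B j C k D l s :
  measurable A -> measurable B -> measurable C -> measurable D ->
  hit4 A (i + s) B (j + s) C (k + s) D (l + s) = hit4 A i B j C k D l.
Proof.
move=> mA mB mC mD; rewrite /hit4; under eq_Rintegral do rewrite !hit_shift.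
rewrite (Rintegral_comp_iter
  (fun x => hit A i x * hit B j x * (hit C k x * hit D l x)))//.
- by do !apply: measurable_funM; exact: measurable_hit.
- by move=> x _; do !apply: mul01; exact: hit01.
Qed.

Hypothesis muX : mu X = 1%E.

Lemma hit2_diag A B i : measurable A -> measurable B ->
  hit2 A i B i = fine (mu (A `&` B)).
Proof.
move=> mA mB; rewrite -[i]add0n hit2_shift// /hit2 -(measure_setI_full mu X mX _ muX)//;
  last exact: measurableI.
rewrite -Rintegral_indic//; last exact: measurableI.
by apply: eq_Rintegral => x _; rewrite /hit/= !indicE in_setI -natrM mulnb.
Qed.

(** * Decorrelation from 4-mixing *)

Variables (C theta : R).
Hypothesis C_ge0 : 0 <= C.
Hypothesis theta_gt0 : 0 < theta.
Hypothesis mix : forall I1 I2 I3 I4 : set R,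
  is_interval I1 -> is_interval I2 -> is_interval I3 -> is_interval I4 ->
  forall a b c : nat, (a < b)%N -> (b <= c)%N ->
    mix4 mu X Tm (\1_I1) (\1_I2) (\1_I3) (\1_I4) a b c
      <= C * expR (- theta * (b - a)%:R).

(** By symmetry the times may be ordered inside each pair. Invariance then moves the earliest time
    [i] to 0, and mixing applies with a = j - i, b = k - i, c = l - i, where b - a = k - j is at
    least [g]. *)
Lemma hit4_mix A i B j D k E l g :
  is_interval A -> is_interval B -> is_interval D -> is_interval E ->
  (0 < g)%N -> (maxn i j + g <= minn k l)%N ->
  `|hit4 A i B j D k E l - hit2 A i B j * hit2 D k E l|
     <= C * expR (- theta * g%:R).
Proof.
wlog ij : A i B j / (i <= j)%N => [wlg iA iB iD iE g0 gap|].
  case/orP: (leq_total i j) => ij; first exact: wlg.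
  by rewrite hit4Cl hit2C; apply: wlg => //; rewrite maxnC.
wlog kl : D k E l / (k <= l)%N => [wlg iA iB iD iE g0 gap|].
  case/orP: (leq_total k l) => kl; first exact: wlg.
  by rewrite hit4Cr (hit2C D); apply: wlg => //; rewrite minnC.
move=> iA iB iD iE g0; rewrite (maxn_idPr ij) (minn_idPl kl) => gap.
have mA := is_interval_measurable iA; have mB := is_interval_measurable iB.
have mD := is_interval_measurable iD; have mE := is_interval_measurable iE.
have -> : hit4 A i B j D k E l =
    hit4 A (0 + i) B (j - i + i) D (k - i + i) E (l - i + i).
  by rewrite !subnK//; lia.
have -> : hit2 A i B j = hit2 A (0 + i) B (j - i + i) by rewrite subnK.
have -> : hit2 D k E l = hit2 D (0 + k) E (l - k + k) by rewrite subnK.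
rewrite hit4_shift// !hit2_shift//.
have ab : (j - i < k - i)%N by lia.
have bc : (k - i <= l - i)%N by lia.
have := mix _ _ _ _ iA iB iD iE _ _ _ ab bc.
rewrite /mix4 /hit4 /hit2 /hit/= (_ : (l - i - (k - i)) = l - k)%N; last by lia.
under [in X in X -> _]eq_Rintegral do rewrite -mulrA.
move=> /le_trans; apply; rewrite ler_wpM2l// ler_expR !mulNr lerN2.
by rewrite ler_wpM2l ?(ltW theta_gt0)// ler_nat; lia.
Qed.

(** Two-fold mixing is the four-fold one with the whole line as second set of each pair, both times
    of a pair being equal. *)
Lemma hit2_mix A i B j g : is_interval A -> is_interval B ->
  (0 < g)%N -> (i + g <= j \/ j + g <= i)%N ->
  `|hit2 A i B j - fine (mu A) * fine (mu B)| <= C * expR (- theta * g%:R).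
Proof.
wlog ij : A i B j / (i + g <= j)%N => [wlg iA iB g0 [ij|ij]|iA iB g0 _].
- by apply: wlg => //; left.
- by rewrite hit2C mulrC; apply: wlg => //; left.
have mA := is_interval_measurable iA; have mB := is_interval_measurable iB.
have iT : is_interval [set: R] by [].
have := @hit4_mix A i _ i B j _ j g iA iT iB iT g0.
rewrite maxnn minnn => /(_ ij); rewrite !hit2_diag// !setIT.
rewrite /hit4; under eq_Rintegral do rewrite !hitT !mulr1.
by [].
Qed.

(** * First and second moments of the collision count *)

Variables (K : finType) (A : K -> set R).
Hypothesis iA : forall k, is_interval (A k).
Hypothesis dA : forall k l, k != l -> A k `&` A l = set0.

Variables (m g : nat).
Hypothesis m_gt0 : (0 < m)%N.
Hypothesis g_gt0 : (0 < g)%N.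

Local Notation eps := (C * expR (- theta * g%:R)).
Local Notation p k := (fine (mu (A k))).
Local Notation S := (\sum_k p k ^+ 2).
Local Notation M := (m%:R : R).

(* [collisions] pairs the time block [g * u] with the block [g * (m + v)], so that
   in its second moment the two early times always precede the two late ones. *)
Definition visits (o : nat) (k : K) (x : R) : R :=
  \sum_(u < m) hit (A k) (g * (o + u)) x.

Definition collisions (x : R) : R := \sum_k visits 0 k x * visits m k x.

Let mA k : measurable (A k).
Proof. exact: is_interval_measurable. Qed.

Let eps_ge0 : 0 <= eps.
Proof. by rewrite mulr_ge0// expR_ge0. Qed.

Lemma cell_prob01 k : 0 <= p k <= 1.
Proof.
rewrite fine_ge0//= -lee_fin fineK ?fin_num_measure//.
exact: probability_le1.
Qed.

(** Distinct times in one block are at least [g] apart, so mixing applies. At equal times, equal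
    cells give [p k] and distinct cells give 0 by disjointness. *)
Lemma hit2_cells_le k l o (u u' : 'I_m) :
  hit2 (A k) (g * (o + u)) (A l) (g * (o + u')) <=
  p k * p l + (k == l)%:R * ((u == u')%:R * p k) + eps.
Proof.
have /andP[pk0 _] := cell_prob01 k; have /andP[pl0 _] := cell_prob01 l.
have [<-{u'}|uu'] := eqVneq u u'.
  rewrite hit2_diag//; have [<-{l pl0}|kl] := eqVneq k l.
    by rewrite setIid !mul1r addrAC lerDr addr_ge0// mulr_ge0.
  by rewrite dA// measure0/= mul0r addr0 addr_ge0 ?mulr_ge0.
rewrite mul0r mulr0 addr0 -lerBlDl.
apply: (le_trans (ler_norm _)); apply: hit2_mix => //.
have : (u != u' :> nat) by [].
rewrite neq_ltn => /orP[] lt; [left|right];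
  by rewrite -mulnSr leq_mul2l -addnS leq_add2l lt orbT.
Qed.

(** Only [m] of the m^2 pairs of times coincide, so the diagonal term carries a single factor [M].
    This is the form that [sum_pair_bound] takes. *)
Lemma sum_hit2_cells_le k l o :
  0 <= \sum_(u < m) \sum_(u' < m)
    hit2 (A k) (g * (o + u)) (A l) (g * (o + u')) <=
  M ^+ 2 * (p k * p l) + (k == l)%:R * (M * p k) + M ^+ 2 * eps.
Proof.
apply/andP; split.
  by apply: sumr_ge0 => u _; apply: sumr_ge0 => u' _; exact: hit2_ge0.
apply: (@le_trans _ _ (\sum_(u < m) \sum_(u' < m)
    (p k * p l + (k == l)%:R * ((u == u')%:R * p k) + eps))).
  by apply: ler_sum => u _; apply: ler_sum => u' _; exact: hit2_cells_le.
rewrite (eq_bigr (fun=> M * (p k * p l) + (k == l)%:R * p k + M * eps)).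
  rewrite sumr_finType_const card_ord; move: eps (p k) (p l) => a b c.
  by rewrite le_eqVlt; apply/orP; left; apply/eqP; ring.
move=> u _; rewrite !big_split/= !sumr_finType_const card_ord.
congr (_ + _ + _); rewrite -mulr_sumr (bigD1 u)//= eqxx mul1r big1 ?addr0//.
by move=> u' u'u; rewrite eq_sym (negbTE u'u) mul0r.
Qed.

Lemma bounded_measurable_visits o k : bounded_measurable X (visits o k).
Proof. by apply: bounded_measurable_sum => u; exact: bounded_measurable_hit. Qed.

Lemma bounded_measurable_collisions : bounded_measurable X collisions.
Proof.
apply: bounded_measurable_sum => k.
by apply: bounded_measurableM; exact: bounded_measurable_visits.
Qed.

(** An early time g u and a late time g (m + v) differ by at least [g], so each of the m^2 pairs
    contributes at least p k ^ 2 - eps for every cell. *)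
Lemma Rintegral_collisions_ge :
  M ^+ 2 * (S - #|K|%:R * eps) <= Rintegral mu X collisions.
Proof.
rewrite Rintegral_sum//; last first.
  by move=> k; apply: bounded_measurableM; exact: bounded_measurable_visits.
rewrite mulrBr mulr_sumr mulrCA -sumr_finType_const.
rewrite -sumrB; apply: ler_sum => k _.
rewrite [leRHS](_ : _ = \sum_(u < m) \sum_(v < m)
    hit2 (A k) (g * (0 + u)) (A k) (g * (m + v))); last first.
  rewrite (eq_bigr (fun u : 'I_m => Rintegral mu X (fun x => \sum_(v < m)
      hit (A k) (g * (0 + u)) x * hit (A k) (g * (m + v)) x))).
    rewrite -Rintegral_sum//.
      by apply: eq_Rintegral => x _; rewrite /visits big_distrlr.
    move=> u; apply: bounded_measurable_sum => v.
    by apply: bounded_measurableM; exact: bounded_measurable_hit.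
  move=> u _; rewrite Rintegral_sum// => v.
  by apply: bounded_measurableM; exact: bounded_measurable_hit.
rewrite [leLHS](_ : _ = \sum_(u < m) \sum_(v < m) (p k ^+ 2 - eps)); last first.
  rewrite !sumr_finType_const card_ord.
  by move: eps (p k) => a b; ring.
apply: ler_sum => u _; apply: ler_sum => v _.
rewrite lerBlDl -lerBlDr expr2; apply: le_trans (ler_norm _) _.
rewrite distrC; apply: hit2_mix => //; left.
by rewrite -mulnSr leq_mul2l add0n ltn_addr ?orbT.
Qed.

(** Replacing each [hit4] by the product of its early and late [hit2] costs eps, in total M^4 eps
    L^2 for L cells. Together with the 5 from [sum_pair_bound] this makes the constant 6. *)
Lemma Rintegral_sqr_collisions_le (t : R) : eps <= 1 -> 0 < t ->
  Rintegral mu X (fun x => collisions x ^+ 2) <=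
  (1 + t) * M ^+ 4 * S ^+ 2 + (1 + t^-1) * M ^+ 2 * S
  + 6 * M ^+ 4 * eps * #|K|%:R ^+ 2.
Proof.
move=> eps1 t0.
have bh k o (u : nat) : bounded_measurable X (hit (A k) (g * (o + u))).
  exact: bounded_measurable_hit.
have b4 k l (u u' v v' : nat) : bounded_measurable X (fun x =>
    hit (A k) (g * (0 + u)) x * hit (A l) (g * (0 + u')) x *
    (hit (A k) (g * (m + v)) x * hit (A l) (g * (m + v')) x)).
  by do !apply: bounded_measurableM.
have -> : Rintegral mu X (fun x => collisions x ^+ 2) =
    \sum_k \sum_l \sum_(u < m) \sum_(u' < m) \sum_(v < m) \sum_(v' < m)
    hit4 (A k) (g * (0 + u)) (A l) (g * (0 + u'))
         (A k) (g * (m + v)) (A l) (g * (m + v')).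
  rewrite [LHS](_ : _ = Rintegral mu X (fun x =>
    \sum_k \sum_l \sum_(u < m) \sum_(u' < m) \sum_(v < m) \sum_(v' < m)
    (hit (A k) (g * (0 + u)) x * hit (A l) (g * (0 + u')) x *
    (hit (A k) (g * (m + v)) x * hit (A l) (g * (m + v')) x)))).
    rewrite Rintegral_sum//; last by move=> *; do !apply: bounded_measurable_sum => ?.
    apply: eq_bigr => k _.
    rewrite Rintegral_sum//; last by move=> *; do !apply: bounded_measurable_sum => ?.
    apply: eq_bigr => l _.
    rewrite Rintegral_sum//; last by move=> *; do !apply: bounded_measurable_sum => ?.
    apply: eq_bigr => u _.
    rewrite Rintegral_sum//; last by move=> *; do !apply: bounded_measurable_sum => ?.
    apply: eq_bigr => u' _.
    rewrite Rintegral_sum//; last by move=> *; do !apply: bounded_measurable_sum => ?.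
    by apply: eq_bigr => v _; rewrite Rintegral_sum.
  apply: eq_Rintegral => x _; rewrite expr2 /collisions big_distrlr/=.
  apply: eq_bigr => k _; apply: eq_bigr => l _.
  (* Regroups the four visit counts by time block instead of by cell. *)
  rewrite mulrACA /visits 2!big_distrlr/= mulr_suml; apply: eq_bigr => u _.
  rewrite mulr_suml; apply: eq_bigr => u' _.
  rewrite mulr_sumr; apply: eq_bigr => v _.
  by rewrite mulr_sumr.
pose J o k l := \sum_(u < m) \sum_(u' < m)
    hit2 (A k) (g * (o + u)) (A l) (g * (o + u')).
apply: (@le_trans _ _ (\sum_k \sum_l (J 0%N k l * J m k l + M ^+ 4 * eps))).
  apply: ler_sum => k _; apply: ler_sum => l _.
  rewrite (_ : _ + _ = \sum_(u < m) \sum_(u' < m) \sum_(v < m) \sum_(v' < m)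
     (hit2 (A k) (g * (0 + u)) (A l) (g * (0 + u'))
     * hit2 (A k) (g * (m + v)) (A l) (g * (m + v')) + eps)).
    apply: ler_sum => u _; apply: ler_sum => u' _; apply: ler_sum => v _.
    apply: ler_sum => v' _; rewrite -lerBlDl.
    apply: le_trans (ler_norm _) _; apply: hit4_mix => //.
    (* Early times are at most g (m - 1) and late times at least g m. *)
    rewrite !add0n -maxnMr -minnMr -mulnSr leq_mul2l.
    have := ltn_ord u; have := ltn_ord u'; lia.
  have -> : M ^+ 4 * eps =
      \sum_(u < m) \sum_(u' < m) \sum_(v < m) \sum_(v' < m) eps.
    by rewrite !sumr_finType_const card_ord; move: eps => a; ring.
  rewrite /J mulr_suml -big_split; apply: eq_bigr => u _ /=.
  rewrite mulr_suml -big_split; apply: eq_bigr => u' _ /=.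
  rewrite mulr_sumr -big_split; apply: eq_bigr => v _ /=.
  by rewrite mulr_sumr -big_split.
under eq_bigr do rewrite big_split/=.
rewrite big_split/=.
have -> : \sum_(k : K) \sum_(l : K) M ^+ 4 * eps = M ^+ 4 * eps * #|K|%:R ^+ 2.
  rewrite !sumr_finType_const.
  by move: (M ^+ 4 * eps) => a; ring.
have := @sum_pair_bound R K (fun k => p k) M eps t (J 0%N) (J m) cell_prob01.
rewrite ler1n eps_ge0 eps1 => /(_ m_gt0 isT t0) /= HJ.
have {HJ} := HJ (fun k l => sum_hit2_cells_le k l 0) (fun k l => sum_hit2_cells_le k l m).
move=> HJ; apply: (le_trans (lerD HJ (lexx _))).
move: eps S => a b; rewrite le_eqVlt; apply/orP; left; apply/eqP; ring.
Qed.

(** With c = 1 / (M^2 S), the square of 1 - c N is 1 where N = 0 and nonnegative elsewhere.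
    Normalising by M^2 S instead of the true mean lets a lower bound on the mean suffice; the
    constants add up to 1 - 2 + (1 + t) = t. *)
Lemma collisions_eq0_le (t : R) : eps <= 1 -> 0 < t -> 0 < S ->
  fine (mu (X `&` collisions @^-1` [set 0])) <=
  t + (1 + t^-1) / (M ^+ 2 * S) + 2 * #|K|%:R * eps / S
  + 6 * eps * #|K|%:R ^+ 2 / S ^+ 2.
Proof.
move=> eps1 t0 S0.
have M0 : 0 < M by rewrite ltr0n.
pose c := (M ^+ 2 * S)^-1.
have c0 : 0 < c by rewrite invr_gt0 mulr_gt0// exprn_gt0.
have bN := bounded_measurable_collisions.
have mD : measurable (X `&` collisions @^-1` [set 0]).
  by case: bN => mN _; exact: mN.
have bc r : bounded_measurable X (fun=> r) by exact: bounded_measurable_cst.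
have b1 : bounded_measurable X (fun x => (- (2 * c)) * collisions x).
  exact: bounded_measurableM.
have b2 : bounded_measurable X (fun x => c ^+ 2 * collisions x ^+ 2).
  by apply: bounded_measurableM => //; exact: bounded_measurableM.
apply: (@le_trans _ _ (Rintegral mu X (fun x =>
    (1 + (- (2 * c)) * collisions x) + c ^+ 2 * collisions x ^+ 2))).
  rewrite -(measure_setI_full mu X mX _ muX)// -Rintegral_indic//.
  apply: le_Rintegral => //.
  - apply: bounded_measurable_integrable => //; split.
      exact: measurable_indic.
    by exists 1 => x _; rewrite ?indicE; case: (_ \in _); rewrite ?normr1 ?normr0.
  - by apply: bounded_measurable_integrable => //; do !apply: bounded_measurableD.
  move=> x Xx; rewrite ?indicE; case: (boolP (_ \in _)) => [|_].
    by rewrite inE => -[_ /= ->]; rewrite expr0n/= !mulr0 !addr0.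
  by have := sqr_ge0 (1 - c * collisions x); rewrite mulr0n; nra.
rewrite RintegralD//; last 2 first.
- by apply: bounded_measurable_integrable => //; exact: bounded_measurableD.
- exact: bounded_measurable_integrable.
rewrite RintegralD//; last 2 first.
- exact: bounded_measurable_integrable.
- exact: bounded_measurable_integrable.
rewrite !RintegralZl//; last 2 first.
- by apply: bounded_measurable_integrable => //; exact: bounded_measurableM.
- exact: bounded_measurable_integrable.
rewrite Rintegral_cst// [fine _](congr1 fine muX : _ = 1) mulr1.
have H1 := Rintegral_collisions_ge.
have H2 := Rintegral_sqr_collisions_le t eps1 t0.
have {}H1 : 2 * c * (M ^+ 2 * (S - #|K|%:R * eps)) <= 2 * c * Rintegral mu X collisions.
  by rewrite ler_wpM2l// mulr_ge0// ltW.
have {}H2 := ler_wpM2l (sqr_ge0 c) H2.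
have E1 : 2 * c * (M ^+ 2 * (S - #|K|%:R * eps)) = 2 - 2 * #|K|%:R * eps / S.
  by rewrite /c; field; rewrite !gt_eqF.
have E2 : c ^+ 2 * ((1 + t) * M ^+ 4 * S ^+ 2 + (1 + t^-1) * M ^+ 2 * S
    + 6 * M ^+ 4 * eps * #|K|%:R ^+ 2) =
    1 + t + (1 + t^-1) / (M ^+ 2 * S) + 6 * eps * #|K|%:R ^+ 2 / S ^+ 2.
  by rewrite /c; field; rewrite !gt_eqF.
lra.
Qed.

End Orbits.

(** * Cells of length [s] and the integral of ball measures *)

Section Cells.
Context {R : realType}.

Definition cell (c s : R) (i : nat) : set R :=
  [set x | c + i%:R * s <= x < c + i.+1%:R * s].

Lemma cell_is_interval c s i : is_interval (cell c s i).
Proof. by move=> x y /andP[? _] /andP[_ ?] z /andP[? ?]; apply/andP; split; lra. Qed.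

Lemma cell_measurable c s i : measurable (cell c s i).
Proof. exact: is_interval_measurable (cell_is_interval c s i). Qed.

Lemma cell_disjoint c s i j : 0 <= s -> i != j -> cell c s i `&` cell c s j = set0.
Proof.
move=> s0; wlog : i j / (i < j)%N => [wlg|ij _].
  by case: (ltngtP i j) => // ij _; [|rewrite setIC]; apply: wlg => //; lia.
apply/seteqP; split => // x [/andP[_ xi] /andP[jx _]].
have : i.+1%:R * s <= j%:R * s by rewrite ler_wpM2r// ler_nat.
lra.
Qed.

Lemma cell_diam c s i x y : cell c s i x -> cell c s i y -> `|x - y| < s.
Proof.
rewrite /cell/= -natr1 => /andP[? ?] /andP[? ?].
by rewrite ltr_norml; apply/andP; split; lra.
Qed.

Lemma cell_cover c s n x : 0 < s -> c <= x < c + n%:R * s ->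
  exists2 i, (i < n)%N & cell c s i x.
Proof.
move=> s0 /andP[cx xn]; pose i := Num.truncn ((x - c) / s).
have xc0 : 0 <= (x - c) / s by rewrite divr_ge0 ?subr_ge0// ltW.
have /andP[ix xi] := truncn_itv xc0.
rewrite -/i ler_pdivlMr// in ix; rewrite -/i ltr_pdivrMr// in xi.
exists i; last by apply/andP; split; lra.
rewrite -(ltr_nat R) -(ltr_pM2r s0); lra.
Qed.

(** The centre lies in a cell of index [i.+1] so that a left neighbour exists among the natural
    indices. *)
Lemma ball_sub_cells c s i r y : r <= s -> cell c s i.+1 y ->
  ball y r `<=` cell c s i `|` (cell c s i.+1 `|` cell c s i.+2).
Proof.
rewrite /cell/= -(natr1 i.+2) -(natr1 i.+1) -(natr1 i) => rs /andP[y1 y2] x.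
rewrite -ball_normE/= ltr_norml => /andP[x1 x2] /=.
have [?|?] := ltP x (c + (i%:R + 1) * s); first by left; apply/andP; split; lra.
have [?|?] := ltP x (c + (i%:R + 1 + 1) * s).
  by right; left; apply/andP; split; lra.
by right; right; apply/andP; split; lra.
Qed.

Variable mu : probability R R.

(** Balls of radius [r] are the sections of the planar strip |x - y| < r. *)
Lemma measurable_fun_measure_ball (r : R) :
  measurable_fun [set: R] (fun y => mu (ball y r)).
Proof.
pose B : set (R * R) := [set z | `|z.1 - z.2| < r].
have mB : measurable B.
  have mf : measurable_fun [set: R * R] (fun z : R * R => `|z.1 - z.2|).
    apply: measurableT_comp => //.
    by apply: measurable_funB; [exact: measurable_fst | exact: measurable_snd].
  have -> : B = [set: R * R] `&` (fun z : R * R => `|z.1 - z.2|) @^-1` [set` `]-oo, r[].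
    by rewrite setTI; apply/seteqP; split => z; rewrite /B/= in_itv.
  exact: mf.
have := measurable_fun_xsection mu mB.
congr (measurable_fun _ _); apply/funext => y /=; congr (mu _).
by apply/seteqP; split => x; rewrite -ball_normE /xsection/= inE.
Qed.

(** Tightness, by continuity from below. It reduces a possibly unbounded [X] to finitely many
    cells. *)
Lemma exists_bounded_full (s e : R) : 0 < s -> 0 < e -> exists n : nat,
  (mu (~` [set x | (- (n%:R * s) <= x < n%:R * s)%R]) <= e%:E)%E.
Proof.
move=> s0 e0; pose I (n : nat) := [set x : R | - (n%:R * s) <= x < n%:R * s].
have mI n : measurable (I n).
  apply: is_interval_measurable => x y /andP[? _] /andP[_ ?] z /andP[? ?].
  by apply/andP; split; lra.
have IT : \bigcup_n I n = [set: R].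
  apply/seteqP; split => // x _; exists (Num.bound `|x / s|) => //=.
  have := archi_boundP (normr_ge0 (x / s)); rewrite [X in X < _]normrM normfV (gtr0_norm s0).
  rewrite ltr_pdivrMr// ltr_norml => /andP[? ?]; apply/andP; split; lra.
have Icvg : (mu (I n)) @[n --> \oo] --> 1%E.
  rewrite -(probability_setT mu) -IT; apply: nondecreasing_cvg_mu => //.
    by rewrite IT.
  move=> i j ij; apply/subsetPset => x /andP[? ?].
  have : i%:R * s <= j%:R * s by rewrite ler_wpM2r ?ler_nat// ltW.
  by move=> ?; apply/andP; split; lra.
have [_ /(cvgr_gt 1)/(_ (1 - e))] := (fine_cvgP _ _).1 Icvg.
rewrite ltrBlDr ltrDl => /(_ e0)[N _ /(_ N)/= /(_ (leqnn _)) HN].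
exists N; rewrite -/(I N) probability_setC// -(fineK (fin_num_measure mu _ (mI N))).
by rewrite -EFinB lee_fin; lra.
Qed.

Variables (X : set R).
Hypothesis mX : measurable X.
Hypothesis muX : mu X = 1%E.

(** As r <= s, a ball centred in a cell lies in that cell and its two neighbours. Integrating gives
    e <= 3 sum p^2 + e / 4, the last term bounding the mass outside a large interval. *)
Lemma sum_sqr_cells_ge (r s e : R) : 0 < r -> r <= s -> 0 < e ->
  (e%:E <= \int[mu]_(y in X) mu (ball y r))%E ->
  exists (c : R) (n : nat), e / 4 <= \sum_(i < n) fine (mu (cell c s i)) ^+ 2.
Proof.
move=> r0 rs e0 He; have s0 : 0 < s by lra.
have [n In] := exists_bounded_full s (e / 4) s0 (divr_gt0 e0 (ltr0n _ 4)).
set I := [set x | _] in In.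
have mI : measurable I.
  apply: is_interval_measurable => x y /andP[? _] /andP[_ ?] z /andP[? ?].
  by apply/andP; split; lra.
(* One cell is added on each side of [I]: cells 1 to 2n fill [I], and every one of them has both
   neighbours among the 2n + 2 cells. *)
pose c := - (n.+1%:R * s).
pose p i := fine (mu (cell c s i)).
have pE i : mu (cell c s i) = (p i)%:E.
  by rewrite /p fineK// fin_num_measure//; exact: cell_measurable.
have p0 i : 0 <= p i by rewrite fine_ge0.
pose w (j : nat) := p j + p j.+1 + p j.+2.
exists c, n.*2.+2.
(* A majorant of the ball measure: the mass of three neighbouring cells on [I], and 1 outside. *)
pose f y : R := \sum_(j < n.*2) w j * \1_(cell c s j.+1) y + \1_(~` I) y.
have b1 A : measurable A -> bounded_measurable X (\1_A : R -> R).
  move=> mA; split; first exact: measurable_indic.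
  by exists 1 => x _; rewrite indicE; case: (_ \in _); rewrite ?normr1 ?normr0.
have b2 (j : nat) : bounded_measurable X (fun y => w j * \1_(cell c s j.+1) y).
  apply: bounded_measurableM; first exact: bounded_measurable_cst.
  exact: b1 (cell_measurable _ _ _).
have b3 : bounded_measurable X (fun y => \sum_(j < n.*2) w j * \1_(cell c s j.+1) y).
  by apply: bounded_measurable_sum => j; exact: b2.
have b4 : bounded_measurable X (\1_(~` I) : R -> R) by apply: b1; exact: measurableC.
have bf : bounded_measurable X f by exact: bounded_measurableD.
have U2 (A B : set R) : measurable A -> measurable B ->
    (mu (A `|` B) <= mu A + mu B)%E by move=> mA mB; exact: measureU2.
have ballf y : (mu (ball y r) <= (f y)%:E)%E.
  have f0 (j : 'I_n.*2) : 0 <= w j * \1_(cell c s j.+1) y.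
    by rewrite mulr_ge0 ?indicE// !addr_ge0.
  have [Iy|nIy] := pselect (I y); last first.
    rewrite (le_trans (probability_le1 mu (measurable_ball _ _)))//.
    rewrite lee_fin /f [X in _ + X]indicE mem_set// lerDr.
    by apply: sumr_ge0 => j _; exact: f0.
  have [j jn cj] : exists2 j, (j < n.*2)%N & cell c s j.+1 y.
    have [|j jn cj] := @cell_cover (- (n%:R * s)) s n.*2 y s0.
      by move: Iy => /andP[? ?]; rewrite -addnn natrD; apply/andP; split; lra.
    exists j => //; move: cj; rewrite /cell /c/= -(natr1 n) -(natr1 j.+1) -(natr1 j).
    by move=> /andP[? ?]; apply/andP; split; lra.
  apply: (@le_trans _ _ (w j)%:E).
    apply: (@le_trans _ _ (mu (cell c s j `|` (cell c s j.+1 `|` cell c s j.+2)))).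
      apply: le_measure; rewrite ?inE.
      - exact: measurable_ball.
      - by do !apply: measurableU; exact: cell_measurable.
      - exact: ball_sub_cells.
    apply: (le_trans (U2 _ _ (cell_measurable _ _ _) _)).
      by apply: measurableU; exact: cell_measurable.
    rewrite /w -addrA EFinD pE leeD2l//.
    apply: (le_trans (U2 _ _ (cell_measurable _ _ _) (cell_measurable _ _ _))).
    by rewrite EFinD !pE.
  rewrite lee_fin /f (bigD1 (Ordinal jn))//= [X in w j * X]indicE mem_set// mulr1.
  by rewrite -addrA lerDl addr_ge0 ?indicE// sumr_ge0.
have {}He : e <= Rintegral mu X f.
  have fi : (\int[mu]_(y in X) (f y)%:E)%E \is a fin_num.
    by apply: integrable_fin_num => //; exact: bounded_measurable_integrable.
  rewrite -lee_fin /Rintegral fineK//; apply: (le_trans He).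
  apply: ge0_le_integral => //.
  - by apply: measurable_funTS; exact: measurable_fun_measure_ball.
  - by apply/measurable_EFinP; case: bf.
have Pind (A : set R) : measurable A -> Rintegral mu X (\1_A) = fine (mu A).
  move=> mA; rewrite Rintegral_indic//; congr fine.
  exact: (measure_setI_full mu X).
have Ef : Rintegral mu X f = \sum_(j < n.*2) w j * p j.+1 + fine (mu (~` I)).
  rewrite RintegralD//; [|exact: bounded_measurable_integrable..].
  rewrite [X in _ + X]Pind; last exact: measurableC.
  congr (_ + _); rewrite Rintegral_sum//.
  apply: eq_bigr => j _; rewrite RintegralZl//; last first.
    apply: bounded_measurable_integrable => //; exact: b1 (cell_measurable _ _ _).
  by rewrite [X in _ * X]Pind//; exact: cell_measurable.
have In' : fine (mu (~` I)) <= e / 4.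
  by rewrite -lee_fin fineK// fin_num_measure//; exact: measurableC.
(* Each product of neighbouring masses is at most half the sum of the squares; the weights 1/2, 2,
   1/2 add up to 3. *)
have wp : \sum_(j < n.*2) w j * p j.+1 <= 3 * \sum_(i < n.*2.+2) p i ^+ 2.
  apply: (@le_trans _ _ (\sum_(j < n.*2)
    (2^-1 * p j ^+ 2 + 2 * p j.+1 ^+ 2 + 2^-1 * p j.+2 ^+ 2))).
    apply: ler_sum => j _; rewrite /w.
    by have := sqr_ge0 (p j - p j.+1); have := sqr_ge0 (p j.+2 - p j.+1); lra.
  rewrite !big_split/= -!mulr_sumr.
  have H0 : \sum_(j < n.*2) p j ^+ 2 <= \sum_(i < n.*2.+2) p i ^+ 2.
    by rewrite !big_ord_recr/= -addrA lerDl addr_ge0// sqr_ge0.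
  have H1 : \sum_(j < n.*2) p j.+1 ^+ 2 <= \sum_(i < n.*2.+2) p i ^+ 2.
    rewrite big_ord_recr big_ord_recl/= addrAC lerDr addr_ge0// sqr_ge0//.
  have H2 : \sum_(j < n.*2) p j.+2 ^+ 2 <= \sum_(i < n.*2.+2) p i ^+ 2.
    by rewrite !big_ord_recl/= addrA lerDr addr_ge0// sqr_ge0.
  lra.
lra.
Qed.

(* Discarding the cells of mass below half of the sum of squares costs at most
   half of that sum, and leaves few cells even when X is unbounded. *)
Lemma exists_cells (r s e : R) : 0 < r -> r <= s -> 0 < e ->
  (e%:E <= \int[mu]_(y in X) mu (ball y r))%E ->
  exists (K : finType) (A : K -> set R),
    [/\ forall k, is_interval (A k),
        forall k l, k != l -> A k `&` A l = set0,
        forall k x y, A k x -> A k y -> `|x - y| < s,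
        #|K|%:R * e <= 8 & e / 8 <= \sum_k fine (mu (A k)) ^+ 2].
Proof.
move=> r0 rs e0 He; have s0 : 0 < s by lra.
have [c [n]] := sum_sqr_cells_ge r s e r0 rs e0 He.
set S := (X in _ <= X) => HS.
pose q (i : 'I_n) := fine (mu (cell c s i)).
pose P := [pred i : 'I_n | S / 2 <= q i].
have q0 i : 0 <= q i by rewrite fine_ge0.
have q1 : \sum_i q i <= 1.
  have tU : trivIset setT (cell c s).
    apply/trivIsetP => i j _ _ ij; apply: cell_disjoint => //; exact: ltW.
  rewrite -lee_fin -sumEFin.
  rewrite (eq_bigr (fun i : 'I_n => mu (cell c s i))); last first.
    by move=> i _; rewrite fineK// fin_num_measure//; exact: cell_measurable.
  have mU : measurable (\big[setU/set0]_(i < n) cell c s i).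
    by apply: bigsetU_measurable => i _; exact: cell_measurable.
  rewrite -measure_bigsetU//; first exact: probability_le1.
  - by move=> i; exact: cell_measurable.
exists 'I_#|P|, (fun k => cell c s (enum_val k : 'I_n)); split.
- by move=> k; exact: cell_is_interval.
- move=> k l kl; apply: cell_disjoint; first exact: ltW.
  by apply: contra kl => /eqP/val_inj/enum_val_inj ->.
- by move=> k x y; exact: cell_diam.
(* Each kept cell has mass at least S / 2 and the total is at most 1, so their number is at most 2 /
   S <= 8 / e. *)
- rewrite card_ord; have : #|P|%:R * (S / 2) <= 1.
    apply: le_trans q1; rewrite -[X in X%:R]card_ord -sumr_finType_const.
    apply: (@le_trans _ _ (\sum_(k < #|P|) q (enum_val k))).
      by apply: ler_sum => k _; have := enum_valP k; rewrite inE.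
    rewrite -(big_enum_val q)/= [leRHS](bigID (mem P))/= lerDl.
    by apply: sumr_ge0 => i _; exact: q0.
  have : (0 : R) <= #|P|%:R by [].
  by nra.
- rewrite -(big_enum_val (fun i => q i ^+ 2))/=.
  have SE : S = \sum_(i in P) q i ^+ 2 + \sum_(i | i \notin P) q i ^+ 2.
    by rewrite /S (bigID (mem P)).
  (* On a light cell q^2 <= (S / 2) q, and the masses sum to at most 1. *)
  have : \sum_(i | i \notin P) q i ^+ 2 <= S / 2.
    apply: (@le_trans _ _ (\sum_(i | i \notin P) S / 2 * q i)).
      apply: ler_sum => i; rewrite inE -ltNge => Pi.
      by rewrite expr2 ler_wpM2r// ltW.
    rewrite -mulr_sumr; apply: ler_piMr; first lra.
    by apply: le_trans q1; rewrite [leRHS](bigID (mem P))/= lerDr sumr_ge0.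
  lra.
Qed.

End Cells.

(** * From measures tending to 1 to a limsup of full measure *)

Lemma measure_limsup_set_eq1 {d : measure_display} {T : measurableType d}
    {R : realType} (mu : probability T R) (F : nat -> set T) :
  (forall n, measurable (F n)) ->
  (forall e : R, 0 < e -> exists N : nat, forall n, (N <= n)%N ->
    1 - e <= fine (mu (F n))) ->
  mu (limsup_set F) = 1%E.
Proof.
move=> mF HF; pose U n := \bigcup_(k in [set k | (n <= k)%N]) F k.
have mU n : measurable (U n) by apply: bigcup_measurable => k _.
(* A tail union contains sets [F k] of measure arbitrarily close to 1; the limsup is the decreasing
   limit of these unions. *)
have U1 n : mu (U n) = 1%E.
  apply/eqP; rewrite eq_le probability_le1//=; apply/lee_subgt0Pr => e e0.
  have [N HN] := HF e e0; have {}HN := HN (maxn N n) (leq_maxl _ _).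
  rewrite -EFinB (@le_trans _ _ (fine (mu (F (maxn N n))))%:E) ?lee_fin//.
  rewrite fineK ?fin_num_measure//; apply: le_measure; rewrite ?inE//.
  by apply: bigcup_sup => /=; exact: leq_maxr.
have -> : limsup_set F = lim_sup_set F.
  apply/seteqP; split => x Hx n; first by move=> _; have [k [nk Fx]] := Hx n; exists k.
  by have [k nk Fx] := Hx n I; exists k; split.
have Ucvg : mu (U n) @[n --> \oo] --> mu (lim_sup_set F).
  apply: lim_sup_set_cvg => //.
  by rewrite (le_lt_trans (probability_le1 mu (mU 0%N)))// ltry.
have UE : (fun n => mu (U n)) = cst 1%E by apply/funext => n; rewrite U1.
by rewrite UE in Ucvg; rewrite -(cvg_lim _ Ucvg)// lim_cst.
Qed.

(** * Collisions force close returns *)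

Section Close.
Context {R : realType}.
Variables (X : set R) (mu : probability R R) (Tm : R -> R).
Hypothesis mX : measurable X.
Hypothesis mT : measurable_fun X Tm.
Hypothesis TX : forall x, X x -> X (Tm x).

Lemma F_set_measurable n (r : R) : measurable (F_set X Tm n r).
Proof.
have -> : F_set X Tm n r = \bigcup_i \bigcup_(j in [set j | (i < j < n)%N])
    (X `&` (fun x => `|iter i Tm x - iter j Tm x|) @^-1` [set` `]-oo, r[]).
  apply/seteqP; split => x.
    move=> [Xx [i [j [ij [jn xr]]]]]; exists i => //; exists j; first exact/andP.
    by split => //=; rewrite in_itv.
  move=> [i _ [j /andP[ij jn] [Xx]]] /=; rewrite in_itv/= => xr.
  by split => //; exists i, j.
apply: bigcupT_measurable => i; apply: bigcup_measurable => j _.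
have mi k : measurable_fun X (iter k Tm).
  by apply: (measurable_comp_iter X Tm mX mT TX id); exact: measurable_id.
have mf : measurable_fun X (fun x => `|iter i Tm x - iter j Tm x|).
  by apply: measurableT_comp => //; exact: measurable_funB.
exact: mf.
Qed.

(** A nonzero term of the count puts the orbit in one cell at times g u < g (m + v) < 2 g m <= n,
    and cells have diameter below [r]. *)
Lemma F_set_collisions (K : finType) (A : K -> set R) (r : R) (m g n : nat) :
  (forall k x y, A k x -> A k y -> `|x - y| < r) ->
  (0 < g)%N -> (g * m.*2 <= n)%N ->
  X `<=` F_set X Tm n r `|` X `&` collisions Tm K A m g @^-1` [set 0].
Proof.
move=> dA g0 gn x Xx; have [Fx|nFx] := pselect (F_set X Tm n r x); first by left.
right; split => //; rewrite /collisions /=; apply: big1 => k _.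
rewrite /visits big_distrlr/=; apply: big1 => u _; apply: big1 => v _.
rewrite /hit !indicE -natrM mulnb.
case: (boolP (_ && _)) => // /andP[]; rewrite !inE => xu xv.
exfalso; apply: nFx; split => //.
exists (g * (0 + u))%N, (g * (m + v))%N; split; last split.
- by rewrite ltn_mul2l g0 add0n ltn_addr.
- by apply: leq_trans gn; rewrite ltn_mul2l g0 -addnn ltn_add2l /=; exact: ltn_ord.
- exact: dA xu xv.
Qed.

End Close.

(** * Error terms and choice of the gap *)

Lemma error_terms_le {R : realType} (x L V e C : R) :
  1 <= x -> 0 <= L <= 8 * x ^+ 2 -> 0 <= V <= 8 * x ^+ 2 -> 0 <= C ->
  0 <= e <= C / x ^+ 10 ->
  2 * L * e * V + 6 * e * L ^+ 2 * V ^+ 2 <= (2 * 64 + 6 * 64 ^+ 2) * (C / x).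
Proof.
move=> x1 /andP[L0 L1] /andP[V0 V1] C0 /andP[e0 e1].
have x0 : 0 < x by lra.
have xn0 : x != 0 by rewrite gt_eqF.
have ix0 : 0 <= x^-1 by rewrite invr_ge0; lra.
have ix1 : x^-1 <= 1 by rewrite invf_le1.
(* [L] will be the number of cells, [V] the inverse of S and [e] the mixing error. The largest
   growth is (L V)^2, of order x^8, which the decay x^(-10) absorbs. *)
have LV : L * V <= 64 * x ^+ 4.
  by rewrite (le_trans (ler_pM L0 V0 L1 V1))// le_eqVlt; apply/orP; left; apply/eqP; ring.
have LV0 : 0 <= L * V by rewrite mulr_ge0.
have H1 : (L * V) * e <= 64 * (C / x).
  rewrite (le_trans (ler_pM LV0 e0 LV e1))//.
  rewrite [leLHS](_ : _ = 64 * (C * (x^-1) ^+ 6)); last by field.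
  rewrite ler_wpM2l// ler_wpM2l//.
  by rewrite exprS ler_piMr// exprn_ile1.
have LV2 : (L * V) ^+ 2 <= (64 * x ^+ 4) ^+ 2.
  by rewrite lerXn2r ?nnegrE// (le_trans LV0).
have H2 : (L * V) ^+ 2 * e <= 64 ^+ 2 * (C / x).
  rewrite (le_trans (ler_pM (sqr_ge0 _) e0 LV2 e1))//.
  rewrite [leLHS](_ : _ = 64 ^+ 2 * (C * (x^-1) ^+ 2)); last by field.
  rewrite ler_wpM2l// ler_wpM2l//.
  by rewrite exprS ler_piMr// exprn_ile1.
rewrite [leLHS](_ : _ = 2 * (L * V * e) + 6 * ((L * V) ^+ 2 * e)); last by ring.
by rewrite [leRHS]mulrDl; apply: lerD; rewrite -[leRHS]mulrA ler_wpM2l.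
Qed.

(** Take g = floor(kappa x) + 1 <= (kappa + 1) x and m = n / (2g) rounded down. The lower bound on
    [x] gives 4 g <= n, hence m > 0. *)
Lemma exists_gap {R : realType} (kappa x : R) (n : nat) :
  0 < kappa -> x = ln n%:R -> 1 <= x -> 8 * (kappa + 1) <= x ->
  exists g m : nat, [/\ (0 < g)%N, (0 < m)%N, (g * m.*2 <= n)%N,
    kappa * x <= g%:R & n%:R <= 4 * (kappa + 1) * x * m%:R].
Proof.
move=> k0 xE x1 x8.
have n0 : (0 : R) < n%:R.
  by rewrite ltNge; apply/negP => n0; move: x1; rewrite xE ln0//; lra.
(* From n = exp x >= x^2 / 2 and x >= 8 (kappa + 1). *)
have xn : 4 * (kappa + 1) * x <= n%:R.
  have := expR_ge1Dxn 1 (le_trans ler01 x1); rewrite xE lnK ?posrE// -xE.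
  have : 8 * (kappa + 1) * x <= x * x by rewrite ler_wpM2r//; lra.
  rewrite expr2 (_ : (2`!)%:R = 2 :> R)//; lra.
pose g := (Num.truncn (kappa * x)).+1.
have kx0 : 0 <= kappa * x by rewrite mulr_ge0//; lra.
have /andP[g1 g2] := truncn_itv kx0; rewrite -/g in g2.
have gK : g%:R <= (kappa + 1) * x by rewrite /g -natr1; lra.
have g4n : (4 * g <= n)%N by rewrite -(ler_nat R) natrM; lra.
exists g, (n %/ (2 * g))%N.
have m0 : (0 < n %/ (2 * g))%N by rewrite divn_gt0 /g//; lia.
split => //.
- by rewrite -mul2n mulnA (mulnC g) mulnC leq_trunc_div.
- exact: ltW.
(* Since m >= 1, n < 2 g (m + 1) <= 4 g m. *)
- have nm : (n <= 4 * g * (n %/ (2 * g)))%N.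
    have := divn_eq n (2 * g); have := @ltn_pmod n (2 * g) isT.
    move: m0; set m := (n %/ _)%N; set q := (n %% _)%N => m0 qg nE.
    have : (2 * g <= m * (2 * g))%N by rewrite leq_pmull.
    lia.
  rewrite (le_trans (_ : _ <= (4 * g * (n %/ (2 * g)))%:R)) ?ler_nat// !natrM.
  by rewrite ler_wpM2r// -mulrA ler_wpM2l.
Qed.

(** * Fixing the parameters for a given accuracy [d] *)

Theorem mainTheorem15 (R : realType) (X : set R) (mu : probability R R)
  (Tm : R -> R) (r : nat -> R) (beta : R) (h : nat -> R) :
  is_interval X ->
  mu X = 1%E ->
  measurable_fun X Tm ->
  (forall x, X x -> X (Tm x)) ->
  (forall A : set R, measurable A -> mu (X `&` Tm @^-1` A) = mu A) ->
  (exists theta' : R, 0 < theta' /\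
     exp_4mixing_BV_Linfty mu X Tm theta' /\
     exists C : R, forall I1 I2 I3 I4 : set R,
       is_interval I1 -> is_interval I2 -> is_interval I3 -> is_interval I4 ->
       forall a b c : nat, (a < b)%N -> (b <= c)%N ->
         mix4 mu X Tm (\1_I1) (\1_I2) (\1_I3) (\1_I4) a b c
           <= C * expR (- theta' * (b - a)%:R)) ->
  (forall n, 0 < r n) ->
  0 < beta ->
  (forall n : nat, (0 < n)%N -> n%:R `^ (- beta) <= r n) ->
  h @ \oo --> +oo ->
  (exists N : nat, forall n : nat, (N <= n)%N ->
     ((ln n%:R ^+ 2 * h n / n%:R ^+ 2)%:E
        <= \int[mu]_(y in X) mu (ball y (r n)))%E) ->
  mu (limsup_set (fun n => F_set X Tm n (4 * r n))) = 1%E.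
Proof.
move=> iX muX mT TX Tinv [th [th0 [_ [C mix]]]] r0 _ _ hoo [N0 HN].
have mX := is_interval_measurable iX.
(* Mixing for the whole line bounds a nonnegative quantity by C times an exponential. *)
have C0 : 0 <= C.
  have iT : is_interval [set: R] by [].
  have := mix _ _ _ _ iT iT iT iT 0%N 1%N 1%N isT isT.
  by move=> /(le_trans (normr_ge0 _)); rewrite pmulr_lge0// expR_gt0.
apply: measure_limsup_set_eq1 => [n|d d0]; first exact: F_set_measurable.
(* This [kappa] makes the mixing error at most C / n^10. The budget [d] is split as d / 4 for [t], d
   / 4 for the variance term and d / 2 for the mixing errors. *)
pose kappa := 10 / th; pose t := d / 4.
have k0 : 0 < kappa by rewrite divr_gt0.
have t0 : 0 < t by rewrite divr_gt0.
pose B : R := 2 * 64 + 6 * 64 ^+ 2.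
have B0 : 0 <= B by rewrite addr_ge0// mulr_ge0// exprn_ge0.
(* The summand 1 ensures h n >= 1. In 128 = 8 * 16, the 8 comes from S >= e / 8 and the 16 from
   squaring n <= 4 (kappa + 1) l m. *)
pose H := 1 + 4 * (1 + t^-1) * (128 * (kappa + 1) ^+ 2) / d.
have [Nh _ HNh] : \forall n \near \oo, H <= h n by move/cvgryPge: hoo; exact.
(* For n above [Y], the three summands give in turn the hypothesis of [exists_gap], a mixing error
   at most 1, and final errors at most d / 2. *)
pose Y := expR (8 * (kappa + 1)) + C + 2 * B * C / d.
have Y1 : 0 < expR (8 * (kappa + 1)) by exact: expR_gt0.
have Y2 : 0 <= 2 * B * C / d by rewrite !mulr_ge0// invr_ge0 ltW.
have Y0 : 0 <= Y by rewrite !addr_ge0// ltW.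
exists (maxn (maxn N0 Nh) (Num.bound Y)) => n.
rewrite !geq_max -andbA => /and3P[/HN He /HNh /= Hh].
rewrite -(ler_nat R) => /(lt_le_trans (archi_boundP Y0)) => {HN HNh hoo}.
set x : R := n%:R; set l := ln x in He * => Yx.
have x0 : 0 < x by lra.
have l8 : 8 * (kappa + 1) <= l.
  by rewrite -(expRK (8 * (kappa + 1))) ler_ln ?posrE//; rewrite /Y in Yx; lra.
have l1 : 1 <= l by lra.
have l0 : 0 < l by lra.
have [g [m [g0 m0 gmn kg nm]]] := exists_gap kappa l n k0 erefl l1 l8.
have h1 : 1 <= h n.
  apply: le_trans Hh; rewrite lerDl divr_ge0 ?(ltW d0)// mulr_ge0//.
    by rewrite mulr_ge0// addr_ge0// invr_ge0 ltW.
  by rewrite mulr_ge0// exprn_ge0//; lra.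
have x1 : 1 <= x.
  by have := expR_ge1Dx l; rewrite lnK ?posrE//; lra.
have x20 : 0 < x ^+ 2 by rewrite exprn_gt0.
set e := l ^+ 2 * h n / x ^+ 2 in He.
(* This polynomial lower bound on [e] is what yields at most 8 n^2 cells and 1 / S <= 8 n^2. *)
have ex : 1 / x ^+ 2 <= e.
  rewrite ler_wpM2r ?invr_ge0 ?(ltW x20)// -[1]mulr1 ler_pM//.
  by rewrite exprn_ege1.
have e0 : 0 < e by apply: lt_le_trans ex; rewrite divr_gt0.
have r4 : r n <= 4 * r n by have := r0 n; lra.
have [K [A [iA dA diamA KL eS]]] := exists_cells mu X mX muX _ _ _ (r0 n) r4 e0 He.
set S := (X in _ <= X) in eS.
have S0 : 0 < S by lra.
have eps10 : C * expR (- th * g%:R) <= C / x ^+ 10.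
  rewrite ler_wpM2l// (_ : (x ^+ 10)^-1 = expR (- (10 * l))); last first.
    by rewrite expRN expRM_natl lnK.
  rewrite ler_expR mulNr lerN2 (_ : 10 = th * kappa); last first.
    by rewrite /kappa mulrC divfK// gt_eqF.
  by rewrite -mulrA ler_wpM2l// ltW.
have eps0 : 0 <= C * expR (- th * g%:R) by rewrite mulr_ge0// expR_ge0.
have eps1 : C * expR (- th * g%:R) <= 1.
  apply: (le_trans eps10); rewrite ler_pdivrMr ?exprn_gt0// mul1r.
  have xC : C <= x by rewrite /Y in Yx; lra.
  by apply: (le_trans xC); rewrite exprS ler_peMr ?exprn_ege1// ltW.
have Z := collisions_eq0_le X mu Tm mX mT TX Tinv muX C th C0 th0 mix K A iA dA
  m g m0 g0 t eps1 t0 S0.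
set P0 := X `&` _ in Z.
have mP0 : measurable P0.
  have [mN _] := bounded_measurable_collisions X Tm mX mT TX K A iA m g.
  exact: mN.
(* The close-return set and the zero set of the count cover [X], so it remains to bound the measure
   of [P0] by [d]. *)
have FP : 1 <= fine (mu (F_set X Tm n (4 * r n))) + fine (mu P0).
  have mF := F_set_measurable X Tm mX mT TX n (4 * r n).
  rewrite -lee_fin EFinD !fineK ?fin_num_measure// -muX.
  apply: le_trans (measureU2 mu mF mP0).
  apply: le_measure; rewrite ?inE//; first exact: measurableU.
  exact: F_set_collisions.
(* The factor l^2 in [e] cancels the l^2 lost because m is only of order n / l; what remains is m^2
   S at least a constant times h n. *)
have T2 : (1 + t^-1) / (m%:R ^+ 2 * S) <= d / 4.
  have MS : h n <= 128 * (kappa + 1) ^+ 2 * (m%:R ^+ 2 * S).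
    have xx : x ^+ 2 <= (4 * (kappa + 1) * l * m%:R) ^+ 2.
      by rewrite lerXn2r ?nnegrE ?(le_trans (ltW x0) nm) ?(ltW x0).
    have : (l ^+ 2 * h n) <= 8 * S * x ^+ 2.
      by rewrite -ler_pdivrMr// -/e; lra.
    move=> lS; have l20 : 0 < l ^+ 2 by rewrite exprn_gt0.
    rewrite -(ler_pM2l l20); apply: (le_trans lS).
    have : 8 * S * x ^+ 2 <= 8 * S * (4 * (kappa + 1) * l * m%:R) ^+ 2.
      by rewrite ler_wpM2l// mulr_ge0// ltW.
    by move=> /le_trans; apply; rewrite le_eqVlt; apply/orP; left; apply/eqP; ring.
  have M20 : 0 < (m%:R : R) ^+ 2 by rewrite exprn_gt0// ltr0n.
  rewrite ler_pdivrMr; last exact: mulr_gt0.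
  have K0 : 0 < 128 * (kappa + 1) ^+ 2 by rewrite mulr_gt0// exprn_gt0//; lra.
  have : 4 * (1 + t^-1) * (128 * (kappa + 1) ^+ 2) / d
      <= 128 * (kappa + 1) ^+ 2 * (m%:R ^+ 2 * S) by rewrite /H in Hh; lra.
  rewrite ler_pdivrMr// => Q; rewrite -(ler_pM2l K0).
  by move: Q; set a := 128 * _; lra.
have T3 : 2 * #|K|%:R * (C * expR (- th * g%:R)) / S
    + 6 * (C * expR (- th * g%:R)) * #|K|%:R ^+ 2 / S ^+ 2 <= d / 2.
  rewrite -exprVn; apply: (@le_trans _ _ (B * (C / x))).
    apply: error_terms_le => //; last by rewrite eps0.
    - rewrite ler0n/= -ler_pdivrMr//; apply: le_trans KL.
      by rewrite ler_wpM2l// -div1r.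
    - rewrite invr_ge0 (ltW S0)/= invf_ple ?posrE ?mulr_gt0//.
      apply: le_trans eS; rewrite invfM mulrC; rewrite -div1r.
      by rewrite ler_wpM2r// invr_ge0.
  rewrite mulrA ler_pdivrMr//.
  have : 2 * B * C / d <= x by rewrite /Y in Yx; lra.
  by rewrite ler_pdivrMr//; lra.
have tE : t = d / 4 by [].
rewrite -/S in Z; lra.
Qed.
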